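(* Let $\mathscr{A}=\langle Q,\Sigma,\delta\rangle$ be a strongly connected synchronizing automaton. For any reset word $w$ of $\mathscr{A}$ of minimum length (among all reset words of $\mathscr{A}$), there is a DFA $\mathscr{B}\in\mathcal{L}(\Sigma)$ with $L[\mathscr{B}]=w^{-1}\Sigma^*w$ and $$\Sigma^{*}w\Sigma^{*}\subseteq \mathrm{Syn}(\mathscr{B})\subseteq \mathrm{Syn}(\mathscr{A})$$ such that $\mathscr{A}$ is a homomorphic image of $\mathscr{B}$.
   Context: $\Sigma$ is a finite non-empty alphabet. A DFA $\langle Q,\Sigma,\delta\rangle$ has a finite non-empty state set $Q$ and a totally defined transition function $\delta:Q\times\Sigma\to Q$, extended to words; it may also carry an initial state $q_0$ and a set $F$ of final states, and then $L[\mathscr{A}]=\{u\in\Sigma^*: \delta(q_0,u)\in F\}$. A word $u$ is reset for $\mathscr{A}$ if $\delta(q,u)=\delta(q',u)$ for all $q,q'\in Q$; $\mathrm{Syn}(\mathscr{A})$ is the set of reset words; $\mathscr{A}$ is synchronizing if $\mathrm{Syn}(\mathscr{A})\ne\emptyset$. It is strongly connected if for each pair of different states $p,q$ some word maps $p$ to $q$. $w^{-1}\Sigma^*w=\{v\in\Sigma^*: wv\in\Sigma^*w\}$. A DFA $\langle Q,\Sigma,\delta,q_0,F\rangle$ is trim if each state is reachable from $q_0$ and each state in $F$ is reachable from some state. $\mathcal{L}(\Sigma)$ is the class of all trim DFAs $\langle Q,\Sigma,\delta,q_0,\{q_0\}\rangle$ (initial state equal to the unique final state) whose recognized language is $w^{-1}\Sigma^*w$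 for some word $w\in\Sigma^*$. A homomorphism from $\langle Q,\Sigma,\delta\rangle$ to $\langle T,\Sigma,\xi\rangle$ is a map $\varphi:Q\to T$ with $\varphi(\delta(q,a))=\xi(\varphi(q),a)$ for all $q\in Q$, $a\in\Sigma$ (initial and final states are ignored); the subautomaton on $\varphi(Q)$ is called a homomorphic image of the first automaton. So ''$\mathscr{A}$ is a homomorphic image of $\mathscr{B}$'' means there is a surjective homomorphism from $\mathscr{B}$ onto $\mathscr{A}$. *)

(* Defs.v *)
From mathcomp Require Import all_boot.

Set Implicit Arguments.
Unset Strict Implicit.
Unset Printing Implicit Defensive.

Section Automata.

Variable Sigma : finType.

Implicit Types (u v w : seq Sigma).

Record dfa := DFA {
  state :> finType;
  trans : state -> Sigma -> state;
  state_gt0 : 0 < #|state|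
}.

Definition run (A : dfa) (q : A) u : A := foldl (@trans A) q u.

Definition strongly_connected (A : dfa) : Prop :=
  forall p q : A, p != q -> exists u, run p u = q.

Definition Syn (A : dfa) : pred (seq Sigma) :=
  [pred u | [forall q : A, forall q' : A, run q u == run q' u]].

Definition synchronizing (A : dfa) : Prop := exists u, u \in Syn A.

Definition min_reset_word (A : dfa) w : Prop :=
  w \in Syn A /\ (forall v, v \in Syn A -> size w <= size v).

Definition homomorphism (A B : dfa) (phi : A -> B) : Prop :=
  forall (q : A) (a : Sigma), phi (trans q a) = trans (phi q) a.

(* A is a homomorphic image of B. *)
Definition homomorphic_image (A B : dfa) : Prop :=
  exists phi : B -> A, homomorphism phi /\ (forall p : A, exists q : B, phi q = p).

Record acceptor := Acceptor {
  underlying :> dfa;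
  init : underlying;
  final : {set underlying}
}.

Definition lang (B : acceptor) : pred (seq Sigma) :=
  [pred u | run (init B) u \in final B].

(* The second clause is weaker than co-accessibility and always holds (take the
   empty word).  For a language w^-1 Sigma^* w co-accessibility follows from the
   first clause: after any word u, reading w leads to a final state. *)
Definition trim (B : acceptor) : Prop :=
  (forall q : B, exists u, run (init B) u = q) /\
  (forall f : B, f \in final B -> exists (q : B) u, run q u = f).

Definition words_ending_with w : pred (seq Sigma) := [pred v | suffix w v].

Definition words_containing w : pred (seq Sigma) := [pred v | infix w v].

Definition left_quotient w (L : pred (seq Sigma)) : pred (seq Sigma) :=
  [pred v | w ++ v \in L].

(* The class of automata usually written with a calligraphic L, L(Sigma). *)
Definition calL (B : acceptor) : Prop :=
  [/\ trim B,
      final B = [set init B] &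
      exists w, lang B =i left_quotient w (words_ending_with w)].

End Automata.

(* Main.v *)
(** The automaton [B] is the part reachable from [(w, Q.w)] of the product of [A]
    with the automaton remembering the last [|w|] letters read.  Since [w] resets
    [A], a run from [(w, Q.w)] whose last [|w|] letters, counting those of the
    initial [w], spell [w] is back at [(w, Q.w)]; so this state alone is final.
    The second projection is the homomorphism onto [A]; it is surjective by strong
    connectivity. *)
Require Import Defs.
From mathcomp Require Import all_boot.

Set Implicit Arguments.
Unset Strict Implicit.
Unset Printing Implicit Defensive.

Section Runs.

Variables (Sigma : finType) (A : dfa Sigma).

Lemma run_cat (q : A) (u v : seq Sigma) : run q (u ++ v) = run (run q u) v.
Proof. exact: foldl_cat. Qed.

Lemma run_rcons (q : A) (u : seq Sigma) (a : Sigma) :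
  run q (rcons u a) = trans (run q u) a.
Proof. by rewrite -cats1 run_cat. Qed.

Lemma SynP (u : seq Sigma) :
  reflect (forall q q' : A, run q u = run q' u) (u \in Syn A).
Proof.
apply: (iffP forallP) => [Au q q' | Au q]; first exact/eqP/(forallP (Au q)).
by apply/forallP => q'; apply/eqP.
Qed.

Lemma run_homomorphism (B : dfa Sigma) (phi : A -> B) :
  homomorphism phi -> forall q u, phi (run q u) = run (phi q) u.
Proof. by move=> phiM q u; elim: u q => //= a u IHu q; rewrite IHu phiM. Qed.

End Runs.

(** Any two states of [A] lift to [B], where the word merges them; [phi] carries the merging
    back. *)
Lemma Syn_homomorphic_image (Sigma : finType) (A B : dfa Sigma) :
  homomorphic_image A B -> {subset Syn B <= Syn A}.
Proof.
case=> phi [phiM phi_onto] u /SynP Bu; apply/SynP => q q'.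
have [[p <-] [p' <-]] := (phi_onto q, phi_onto q').
by rewrite -!(run_homomorphism phiM) (Bu p p').
Qed.

Section Reachable.

Variables (Sigma : finType) (C : dfa Sigma) (c : C).

Definition step : rel C := [rel x y | [exists a, trans x a == y]].

(** Reachability is expressed by the boolean [connect], so that the subtype is again finite;
    [connect_stepP] recovers the words. *)
Definition reachable_state : finType := {x : C | connect step c x}.

Lemma connect_trans_step (x : C) (a : Sigma) :
  connect step c x -> connect step c (trans x a).
Proof.
move=> cx; apply: connect_trans cx (connect1 _).
by apply/existsP; exists a.
Qed.

Definition reachable_trans (x : reachable_state) (a : Sigma) : reachable_state :=
  exist _ (trans (val x) a) (connect_trans_step a (valP x)).

Definition reachable_init : reachable_state := exist _ c (connect0 step c).

Lemma reachable_state_gt0 : 0 < #|reachable_state|.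
Proof. by apply/card_gt0P; exists reachable_init. Qed.

Definition reachable_dfa : dfa Sigma := DFA reachable_trans reachable_state_gt0.

Definition reachable_acceptor : acceptor Sigma :=
  @Acceptor Sigma reachable_dfa reachable_init [set reachable_init].

Lemma val_run_reachable (x : reachable_dfa) (u : seq Sigma) :
  val (run x u) = run (val x) u.
Proof. by elim: u x => //= a u IHu x; rewrite IHu. Qed.

Lemma connect_stepP (x : C) : connect step c x -> exists u, run c u = x.
Proof.
(* Paths are peeled from the end, where [run] appends its last letter. *)
case/connectP => p; elim/last_ind: p x => [|p y IHp] x /=.
  by move=> _ ->; exists [::].
rewrite rcons_path last_rcons => /andP[cp /existsP[a /eqP py]] ->.
by have [u cu] := IHp _ cp erefl; exists (rcons u a); rewrite run_rcons cu.
Qed.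

Lemma trim_reachable : trim reachable_acceptor.
Proof.
split=> [x | f _]; last by exists f, [::].
have [u cu] := connect_stepP (valP x).
by exists u; apply: val_inj; rewrite val_run_reachable.
Qed.

Lemma lang_reachable (u : seq Sigma) :
  (u \in lang reachable_acceptor) = (run c u == c).
Proof. by rewrite inE in_set1 -val_eqE /= val_run_reachable. Qed.

Lemma Syn_reachable : {subset Syn C <= Syn reachable_dfa}.
Proof.
move=> u /SynP Cu; apply/SynP => x y; apply: val_inj.
by rewrite !val_run_reachable (Cu (val x) (val y)).
Qed.

End Reachable.

Section Window.

Variables (Sigma : finType) (A : dfa Sigma) (n : nat).

(** Appending before dropping keeps the length equal to [n] even for [n = 0]. *)
Definition shift (t : n.-tuple Sigma) (a : Sigma) : n.-tuple Sigma :=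
  behead_tuple (rcons_tuple t a).

Lemma val_foldl_shift (t : n.-tuple Sigma) (u : seq Sigma) :
  foldl shift t u = drop (size u) (t ++ u) :> seq Sigma.
Proof.
elim: u t => [|a u IHu] t /=; first by rewrite cats0 drop0.
(* Since [rcons t a] is nonempty, its [behead] accounts for one more letter dropped. *)
by rewrite IHu -cat_rcons /=; case: (rcons t a) (size_rcons t a).
Qed.

Definition window_trans (x : n.-tuple Sigma * A) (a : Sigma) :=
  (shift x.1 a, trans x.2 a).

Variable t0 : n.-tuple Sigma.

Lemma window_state_gt0 : 0 < #|{: n.-tuple Sigma * A}|.
Proof.
have /card_gt0P[q _] := state_gt0 A.
by apply/card_gt0P; exists (t0, q).
Qed.

Definition window_dfa : dfa Sigma := DFA window_trans window_state_gt0.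

Lemma run_window (t : n.-tuple Sigma) (q : A) (u : seq Sigma) :
  run ((t, q) : window_dfa) u = (foldl shift t u, run q u).
Proof. by elim: u t q => //= a u IHu t q; rewrite IHu. Qed.

End Window.

Section ResetWord.

Variables (Sigma : finType) (A : dfa Sigma) (w : seq Sigma).
Hypothesis Aw : w \in Syn A.

Let W := window_dfa A (in_tuple w).

(** Reading [w] fills the whole window with [w] and resets the component in [A], whatever was read
    before. *)
Lemma Syn_window : {subset words_containing w <= Syn W}.
Proof.
move=> _ /infixP[u [v ->]]; apply/SynP => x y.
rewrite !run_cat; congr run.
case: (run x u) (run y u) => [t q] [t' q'].
rewrite !run_window (SynP A w Aw q q'); congr pair; apply: val_inj.
by rewrite /= !val_foldl_shift !drop_size_cat ?size_tuple.
Qed.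

Lemma run_window_return (q : A) (v : seq Sigma) :
  let c : W := (in_tuple w, run q w) in
  (run c v == c) = suffix w (w ++ v).
Proof.
rewrite /= run_window xpair_eqE -val_eqE /= val_foldl_shift suffixE.
rewrite size_cat addKn; apply: andb_idr => /eqP dw.
(* Once the window is [w] again, [w ++ v] ends with [w], so its run from [q] ends by reading [w]
   from some state, and thus in [run q w]. *)
rewrite -run_cat -(cat_take_drop (size v) (w ++ v)) dw run_cat.
exact/eqP/SynP.
Qed.

End ResetWord.

Theorem theorem6 (Sigma : finType) (Sigma_gt0 : 0 < #|Sigma|)
    (A : dfa Sigma) (A_sc : strongly_connected A) (A_sync : synchronizing A)
    (w : seq Sigma) (w_min : min_reset_word A w) :
  exists B : acceptor Sigma,
    [/\ calL B,
        lang B =i left_quotient w (words_ending_with w),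
        {subset words_containing w <= Syn B},
        {subset Syn B <= Syn A} &
        homomorphic_image A B].
Proof.
have [Aw _] := w_min; have /card_gt0P[q _] := state_gt0 A.
(* The choice of [q] is immaterial: [w] sends all states of [A] to the same one. *)
pose c : window_dfa A (in_tuple w) := (in_tuple w, run q w).
pose B := reachable_acceptor c.
have langB : lang B =i left_quotient w (words_ending_with w).
  by move=> v; rewrite lang_reachable run_window_return.
have imB : homomorphic_image A B.
  exists (fun x => (val x).2); split=> // p.
  have [u <-] : exists u, run (run q w) u = p.
    (* Strong connectivity speaks of distinct states only; the empty word covers equality. *)
    by have [<-|/A_sc //] := eqVneq (run q w) p; exists [::].
  exists (run (init B) u).
  by have /(congr1 snd) := val_run_reachable (init B) u; rewrite run_window.
exists B; split=> //.
- by split=> //; [apply: trim_reachable | exists w].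
- by move=> v /(Syn_window Aw)/Syn_reachable; apply.
- exact: Syn_homomorphic_image.
Qed.
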